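(* Let $m\ge 1$ be an integer. There exists a sequence $\Sigma=(a_1,\ldots,a_n)$ of $n$ integers that is $m$-th evaluation distinct and $M$-bounded, for some $M$ satisfying $$M\leq 2^{n(1+o(1))}\qquad\text{for } n\to\infty.$$
   Context: Here $[1,n]=\{1,\ldots,n\}$. A sequence $\Sigma=(a_1,\ldots,a_n)$ of integers is $M$-bounded if $a_i\in[0,M]$ for every $i$. For $A\subseteq[1,n]$, $$e^m_{\Sigma}(A)=\sum_{\{i_1<\cdots<i_m\}\subseteq A}a_{i_1}\cdots a_{i_m},$$ with the convention $e^m_\Sigma(A)=0$ if $|A|<m$. The sequence $\Sigma$ is $m$-th evaluation distinct if $e^m_\Sigma(A_1)\ne e^m_\Sigma(A_2)$ for all distinct $A_1,A_2\subseteq[1,n]$ of size at least $m$. $o(1)$ denotes a quantity tending to $0$ as $n\to\infty$ with $m$ fixed. *)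

(* Defs.v *)
From HB Require Import structures.
From mathcomp Require Import all_boot all_order all_algebra.
From mathcomp Require Import all_classical all_reals all_analysis.

Set Implicit Arguments.
Unset Strict Implicit.
Unset Printing Implicit Defensive.

Import Order.TTheory GRing.Theory Num.Theory.
Import numFieldNormedType.Exports.

Local Open Scope ring_scope.

(* The index set [1, n] is represented by 'I_n. *)

Definition bounded_seq (n : nat) (M : int) (Sigma : 'I_n -> int) : Prop :=
  forall i : 'I_n, 0 <= Sigma i <= M.

(* The convention e^m(A) = 0 for #|A| < m is automatic: the sum is empty. *)
Definition evaluation (n m : nat) (Sigma : 'I_n -> int) (A : {set 'I_n}) : int :=
  \sum_(B : {set 'I_n} | (B \subset A) && (#|B| == m)) \prod_(i in B) Sigma i.

Definition evaluation_distinct (n m : nat) (Sigma : 'I_n -> int) : Prop :=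
  forall A1 A2 : {set 'I_n},
    (m <= #|A1|)%N -> (m <= #|A2|)%N -> A1 <> A2 ->
    evaluation m Sigma A1 <> evaluation m Sigma A2.

(* Main.v *)
(** Put [q = 2 ^ t] with [C(n, m) < q] and [a_i = 1 + q 2^i] for [i < n].
    Modulo [q] every [a_i] is [1], so [e^m(A)] determines [C(#|A|, m) < q] and
    hence [#|A|].  If [#|A1| = #|A2| = k] and [i] is the least index at which
    the two sets differ, then modulo [q^2 2^i] the difference of the
    evaluations is [q C(k-1, m-1)] times the difference of the sums of the
    [2^j].  The latter is an odd multiple of [2^i], so equal evaluations would
    force [q] to divide [C(k-1, m-1)], which is positive and smaller than [q].
    Taking [t] least, [t = O(m log n) = o(n)] and all [a_i <= 2 ^ (n + t)]. *)

Require Import Defs.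
From HB Require Import structures.
From mathcomp Require Import all_boot all_order all_algebra.
From mathcomp Require Import all_classical all_reals all_analysis.
From mathcomp Require Import ring zify.

Set Implicit Arguments.
Unset Strict Implicit.
Unset Printing Implicit Defensive.

Import Order.TTheory GRing.Theory Num.Theory.
Import numFieldNormedType.Exports.

Local Open Scope classical_set_scope.
Local Open Scope ring_scope.

(** First-order Taylor expansion in [d]. For empty [P] the truncated exponent [#|P|.-1] is harmless,
    since the sum it multiplies vanishes. *)
Lemma prod_addM_expand2 (S : comNzRingType) (I : finType) (P : {pred I})
    (y d : S) (u : I -> S) :
  exists r, \prod_(j in P) (y + d * u j) =
    y ^+ #|P| + d * (\sum_(j in P) u j) * y ^+ #|P|.-1 + d ^+ 2 * r.
Proof.
rewrite -big_enum -[\sum_(j in P) u j]big_enum /= cardE.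
elim: (enum P) => [|j s [r IHs]]; first by exists 0; rewrite !big_nil /=; ring.
rewrite !big_cons IHs; case: s {IHs} => [|k s] /=.
  by exists (y * r + d * u j * r); rewrite big_nil; ring.
by exists (u j * (\sum_(i <- k :: s) u i) * y ^+ size s
  + y * r + d * u j * r); rewrite !exprS; ring.
Qed.

Lemma coef_add1X_exp (k m : nat) :
  ((1 + 'X) ^+ k : {poly int})`_m = 'C(k, m)%:R.
Proof.
rewrite addrC exprD1n coef_sum; have [km|mk] := ltnP k m.
  rewrite bin_small // big1 // => i _; rewrite coefMn coefXn.
  by have /ltn_eqF := leq_trans (ltn_ord i) km; rewrite eq_sym => ->; rewrite mul0rn.
have mk1 : (m < k.+1)%N by [].
rewrite (bigD1 (Ordinal mk1)) //= coefMn coefXn eqxx big1 ?addr0 // => i.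
rewrite -val_eqE /= coefMn coefXn eq_sym => /negPf->; by rewrite mul0rn.
Qed.

(** Vieta: distributing the product over subsets [B], each contributes a multiple of ['X ^+ #|B|].
    Congruences between evaluations thus become congruences between polynomials. *)
Lemma evaluation_coef n m (Sigma : 'I_n -> int) (A : {set 'I_n}) :
  evaluation m Sigma A = (\prod_(j in A) (1 + (Sigma j)%:P * 'X))`_m.
Proof.
pose F j := if j \in A then (Sigma j)%:P * 'X else 0 : {poly int}.
rewrite big_mkcond (eq_bigr (fun j => F j + 1)); last first.
  by move=> j _; rewrite /F; case: ifP => _; rewrite ?add0r // addrC.
rewrite bigA_distr coef_sum /evaluation.
rewrite [RHS](bigID (fun B : {set 'I_n} => B \subset A)) /=.
rewrite [X in _ + X]big1 ?addr0; last first.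
  move=> B /fintype.subsetPn[j jB jA].
  by rewrite (bigD1 j) //= jB /F (negPf jA) mul0r coef0.
rewrite [LHS]big_mkcondr; apply: eq_big => [//|B sBA].
rewrite -big_mkcond /= (eq_bigr (fun j => (Sigma j)%:P * 'X)); last first.
  by move=> j jB; rewrite /F (fintype.subsetP sBA).
rewrite big_split /= prodr_const -rmorph_prod /= coefCM coefXn eq_sym.
by case: eqP => _; rewrite ?mulr1 ?mulr0.
Qed.

Lemma ltn_bin2l (m k1 k2 : nat) :
  (0 < m <= k2)%N -> (k1 < k2)%N -> ('C(k1, m) < 'C(k2, m))%N.
Proof.
case: m k2 => [|m] [|k2] //= mk2 k12; rewrite binS ltnS in k12 *.
apply: leq_ltn_trans (leq_bin2l _ k12) _.
by rewrite -[ltnLHS]addn0 ltn_add2l bin_gt0.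
Qed.

Lemma leq_bin_exp (n m : nat) : ('C(n, m) <= n ^ m)%N.
Proof.
elim: n m => [|n IHn] [|m]; rewrite ?bin0 ?bin0n //.
rewrite binS (leq_trans (leq_add (IHn _) (IHn _))) //.
rewrite expnS -mulSnr expnS.
by rewrite leq_mul2l; case: m => [|m]; rewrite ?expn0 //= leq_exp2r // leqnSn.
Qed.

(** Only the term [j = k] can be odd. *)
Lemma sum_exp2_parity n (A : {set 'I_n}) (k : 'I_n) :
  exists s : int, \sum_(j in [set j in A | (k <= j)%N]) 2 ^+ (j - k)
    = (k \in A)%:R + 2 * s.
Proof.
rewrite (bigID (pred1 k)) /=.
exists (\sum_(j in [set j in A | (k <= j)%N] | j != k) 2 ^+ (j - k).-1).
congr (_ + _); last first.
  rewrite mulr_sumr; apply: eq_bigr => j.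
  rewrite inE -val_eqE /= => /andP[/andP[_ kj] jk].
  by rewrite -exprS prednK // subn_gt0 ltn_neqAle eq_sym jk.
case kA: (k \in A); last first.
  rewrite big1 // => j /andP[]; rewrite inE => /andP[jA _] /eqP jk.
  by rewrite -jk jA in kA.
rewrite (big_pred1 k) ?subnn // => j /=; rewrite inE.
by case: eqP => [->|]; rewrite ?kA ?leqnn ?andbF.
Qed.

Definition shifted_power (t n : nat) (i : 'I_n) : int := 1 + 2 ^+ (t + i).

Definition eval_poly (t n : nat) (A : {set 'I_n}) : {poly int} :=
  \prod_(j in A) (1 + (shifted_power t j)%:P * 'X).

Lemma eval_poly_mod t n (A : {set 'I_n}) :
  exists r, eval_poly t A = (1 + 'X) ^+ #|A| + (2 ^+ t)%:P * r.
Proof.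
have [r er] := @prod_addM_expand2 {poly int} _ (mem A) (1 + 'X) ((2 ^+ t)%:P)
  (fun j : 'I_n => (2 ^+ j)%:P * 'X).
eexists; rewrite /eval_poly; transitivity (\prod_(j in A)
    (1 + 'X + (2 ^+ t)%:P * ((2 ^+ j)%:P * 'X : {poly int}))).
  by apply: eq_bigr => j _; rewrite /shifted_power exprD polyCD polyCM; ring.
by rewrite er expr2 -!mulrA -addrA -mulrDr.
Qed.

(** As all indices are at least [i], the factor [2 ^+ i] joins the perturbation [d], and the
    second-order remainder gains [2 ^+ i] squared. *)
Lemma eval_poly_high_mod t n (A : {set 'I_n}) (i : nat) :
  (forall j, j \in A -> (i <= j)%N) ->
  exists r, eval_poly t A = (1 + 'X) ^+ #|A|
    + (2 ^+ t * 2 ^+ i * \sum_(j in A) 2 ^+ (j - i))%:P * 'X * (1 + 'X) ^+ #|A|.-1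
    + (2 ^+ t * 2 ^+ i)%:P ^+ 2 * r.
Proof.
move=> leiA.
have [r er] := @prod_addM_expand2 {poly int} _ (mem A) (1 + 'X)
  ((2 ^+ t * 2 ^+ i)%:P * 'X) (fun j : 'I_n => (2 ^+ (j - i))%:P).
exists ('X^2 * r); transitivity (\prod_(j in A)
    (1 + 'X + (2 ^+ t * 2 ^+ i)%:P * 'X * (2 ^+ (j - i))%:P : {poly int})).
  apply: eq_bigr => j /leiA ij.
  by rewrite /shifted_power -{1}(subnK ij) !exprD !polyCD !polyCM; ring.
by rewrite er -rmorph_sum /= !polyCM; ring.
Qed.

Lemma eval_poly_split t n (A : {set 'I_n}) (i : nat) :
  eval_poly t A = eval_poly t [set j in A | (j < i)%N]
                * eval_poly t [set j in A | (i <= j)%N].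
Proof.
rewrite /eval_poly (bigID (fun j : 'I_n => (j < i)%N)) /=.
by congr (_ * _); apply: eq_bigl => j; rewrite inE // -leqNgt.
Qed.

Lemma card_split n (A : {set 'I_n}) (i : nat) :
  #|A| = (#|[set j in A | (j < i)%N]| + #|[set j in A | (i <= j)%N]|)%N.
Proof.
rewrite -!sum1_card (bigID (fun j : 'I_n => (j < i)%N)) /=.
by congr (_ + _)%N; apply: eq_bigl => j; rewrite inE // -leqNgt.
Qed.

Lemma evaluation_mod t n m (A : {set 'I_n}) : exists r,
  evaluation m (@shifted_power t n) A = 'C(#|A|, m)%:R + 2 ^+ t * r.
Proof.
have [r er] := eval_poly_mod t A; exists r`_m.
by rewrite evaluation_coef -/(eval_poly t A) er coefD coefCM coef_add1X_exp.
Qed.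

(** Below [k] the sets share one factor, needed only modulo [2 ^+ t]; the factors from [k] on are
    expanded to second order, and their leading terms cancel because they have equal degree. *)
Lemma evaluation_sub_mod t n m (A1 A2 : {set 'I_n}) (k : 'I_n) :
  #|A1| = #|A2| -> k \in A1 -> k \notin A2 ->
  (forall j : 'I_n, (j < k)%N -> (j \in A1) = (j \in A2)) ->
  exists s r : int,
    evaluation m.+1 (@shifted_power t n) A1
      - evaluation m.+1 (@shifted_power t n) A2
    = 2 ^+ t * 2 ^+ k * ((1 + 2 * s) * 'C(#|A1|.-1, m)%:R + 2 ^+ t * r).
Proof.
move=> cardA kA1 kA2 eqlow.
have eqL : [set j in A1 | (j < k)%N] = [set j in A2 | (j < k)%N].
  by apply/setP => j; rewrite !inE; case jk: (j < k)%N; rewrite ?andbF // eqlow.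
have cardA1 := card_split A1 k; have := card_split A2 k.
rewrite -cardA {1}cardA1 eqL => /addnI cardH.
have high (A : {set 'I_n}) (j : 'I_n) :
    j \in [set j in A | (k <= j)%N] -> (k <= j)%N.
  by rewrite inE => /andP[].
have [r0 e0] := eval_poly_mod t [set j in A2 | (j < k)%N].
have [r1 e1] := eval_poly_high_mod t (@high A1).
have [r2 e2] := eval_poly_high_mod t (@high A2).
have [s1 es1] := sum_exp2_parity A1 k.
have [s2 es2] := sum_exp2_parity A2 k.
rewrite !evaluation_coef -!/(eval_poly t _) -coefB.
rewrite (eval_poly_split t A1 k) (eval_poly_split t A2 k) eqL e0 e1 e2 -cardH.
rewrite es1 es2 kA1 (negPf kA2).
set h := #|[set j in A1 | (k <= j)%N]|; set l := #|[set j in A2 | (j < k)%N]|.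
have h0 : (0 < h)%N by apply/card_gt0P; exists k; rewrite inE kA1 leqnn.
have eA : #|A1|.-1 = (l + h.-1)%N.
  by rewrite cardA1 eqL -/h -/l; case: h h0 => // h' _; rewrite addnS.
pose s : int := s1 - s2.
(* All that keeps a further factor [2 ^+ t]: the first-order difference times the error [r0] of the
   common factor, then the second-order remainders times that factor. *)
pose r : {poly int} := (1 + 2 * s)%:P * 'X * (1 + 'X) ^+ h.-1 * r0
  + (2 ^+ k)%:P * ((1 + 'X) ^+ l + (2 ^+ t)%:P * r0) * (r1 - r2).
pose p : {poly int} := (2 ^+ t * 2 ^+ k)%:P *
  ((1 + 2 * s)%:P * ('X * (1 + 'X) ^+ #|A1|.-1) + (2 ^+ t)%:P * r).
exists s, r`_m.+1; transitivity p`_m.+1.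
  congr ((polyseq _)`_m.+1); rewrite /p eA exprD /r /s.
  rewrite !(polyCD, polyCM, polyCB, polyCN, polyC0, polyC1); ring.
by rewrite !(coefCM, coefD, coefXM) /= coef_add1X_exp.
Qed.

Lemma shifted_power_distinct t n m : (0 < m)%N -> ('C(n, m) < 2 ^ t)%N ->
  evaluation_distinct m (@shifted_power t n).
Proof.
move=> m0 Ct A1 A2 mA1 mA2 neqA eqE.
have Clt (A : {set 'I_n}) : ('C(#|A|, m) < 2 ^ t)%N.
  apply: leq_ltn_trans Ct; apply: leq_bin2l.
  by rewrite -[leqRHS]card_ord max_card.
have cardA : #|A1| = #|A2|.
  have [r1 e1] := evaluation_mod t m A1; have [r2 e2] := evaluation_mod t m A2.
  have : (('C(#|A1|, m) : int) = 'C(#|A2|, m) %[mod (2 ^ t)%N])%Z.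
    apply/eqP; rewrite eqz_mod_dvd; apply/dvdzP; exists (r2 - r1).
    move: eqE; rewrite e1 e2 => /eqP; rewrite -subr_eq0 => /eqP e.
    rewrite -[RHS]addr0 -e !natz -[X in _ * X]natz natrX; ring.
  rewrite !modz_nat !modn_small // => -[eqC].
  (* ['C(-, m)] is strictly increasing as soon as the larger argument is at least [m]. *)
  case: (ltngtP #|A1| #|A2|) => // lt.
    by have := @ltn_bin2l m _ _ _ lt; rewrite eqC ltnn m0 mA2 => /(_ isT).
  by have := @ltn_bin2l m _ _ _ lt; rewrite eqC ltnn m0 mA1 => /(_ isT).
have [k0 k0P] : exists k, (k \in A1) != (k \in A2).
  apply/existsP; apply: contra_notT neqA; rewrite negb_exists => /forallP eqA.
  by apply/setP => j; have /negPn/eqP := eqA j.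
have [k kP kmin] :=
  @arg_minnP _ k0 (fun k => (k \in A1) != (k \in A2)) (@nat_of_ord n) k0P.
have {}kmin (j : 'I_n) : (j < k)%N -> (j \in A1) = (j \in A2).
  by move=> jk; apply/eqP; apply: contraTT jk => /kmin; rewrite -leqNgt.
wlog kA1 : A1 A2 {neqA k0P} mA1 mA2 eqE cardA kP kmin / k \in A1.
  move=> W; case kA1: (k \in A1); first exact: (W A1 A2).
  apply: (W A2 A1) => //; first by rewrite eq_sym.
    by move=> j /kmin.
  by move: kP; rewrite kA1; case: (k \in A2).
have kA2 : k \notin A2 by move: kP; rewrite kA1; case: (k \in A2).
case: m m0 Ct mA1 mA2 eqE Clt => // m _ _ mA1 _ eqE Clt.
have [s [r]] := evaluation_sub_mod t m cardA kA1 kA2 kmin.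
rewrite eqE subrr => /esym/eqP.
rewrite !mulf_eq0 !expf_eq0 /= !andbF /= => /eqP e0.
have : ((2 ^+ t : int) %| (1 + 2 * s) * 'C(#|A1|.-1, m)%:R)%Z.
  apply/dvdzP; exists (- r); rewrite mulNr [r * _]mulrC.
  by apply/eqP; rewrite -addr_eq0 e0.
(* The odd factor [1 + 2 * s] is coprime to [2], by the Bezout relation
   [- s * 2 + (1 + 2 * s) = 1]. *)
rewrite Gauss_dvdzr; last first.
  apply: coprimezXl; apply/coprimezP; exists (- s, 1) => /=; ring.
have [a eA] : exists a, #|A1| = a.+1 by case: #|A1| mA1 => // a; exists a.
(* By Pascal's rule ['C(a, m)] is at most ['C(a.+1, m.+1)], hence below [2 ^ t]; being positive, it
   is not divisible by [2 ^ t]. *)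
move: mA1 (Clt A1); rewrite eA /= ltnS => ma; rewrite binS => lt.
rewrite -natrX !natz dvdzE /= => /dvdn_leq; rewrite bin_gt0 => /(_ ma).
by rewrite leqNgt (leq_ltn_trans (leq_addl _ _) lt).
Qed.

(** Squaring gives a bound linear in [n] without real logarithms: the exponent is at most [m] times
    the binary length of [n], whose square is [O(n)]. *)
Lemma sqr_up_log_bin_le n m : (0 < m)%N ->
  (up_log 2 'C(n, m).+1 ^ 2 <= 4 * m ^ 2 * n)%N.
Proof.
case: n => [|n] m0; first by case: m m0.
set s := trunc_log 2 n.+1.
have sn : (2 ^ s <= n.+1)%N by apply: trunc_logP.
have ns : (n.+1 < 2 ^ s.+1)%N by apply: trunc_log_ltn.
have us : (up_log 2 'C(n.+1, m).+1 <= s.+1 * m)%N.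
  apply: up_log_min => //; rewrite expnM.
  by rewrite (leq_ltn_trans (leq_bin_exp _ _)) // ltn_exp2r.
have s2 : (s.+1 ^ 2 <= 4 * 2 ^ s)%N.
  (* The inductive step needs [(u + 4)^2 <= 2 (u + 3)^2]; its analogue fails for the smaller values,
     which are checked directly. *)
  elim: (s) => [//|[//|[//|u] IHu]]; rewrite [(2 ^ u.+3)%N]expnS; nia.
have := leq_mul (leqnn (m ^ 2)) (leq_trans s2 (leq_mul (leqnn 4) sn)).
by rewrite -expnMn mulnCA mulnA; apply: leq_trans; rewrite leq_exp2r // mulnC.
Qed.

Lemma up_log_bin_div_cvg0 (R : realType) m : (0 < m)%N ->
  (up_log 2 'C(n, m).+1)%:R / n%:R @[n --> \oo] --> (0 : R).
Proof.
move=> m0; apply/cvgrPdist_le => e e0; near=> n.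
have n0 : 0 < n%:R :> R by near: n; exact: nbhs_infty_gtr.
rewrite sub0r normrN ger0_norm ?divr_ge0 // ler_pdivrMr //.
rewrite -(@ler_pXn2r _ 2) ?nnegrE ?mulr_ge0 ?(ltW e0) //.
(* It remains to have [4 m^2 n <= (e n)^2], true once [n >= 4 m^2 / e^2]. *)
apply: (@le_trans _ _ (4 * m ^ 2 * n)%:R).
  by rewrite -natrX ler_nat sqr_up_log_bin_le.
rewrite exprMn expr2 natrM expr2 [e * e * _]mulrA ler_pM2r //.
rewrite -ler_pdivrMl ?mulr_gt0 //.
by near: n; exact: nbhs_infty_ger.
Unshelve. all: by end_near. Qed.

Theorem theorem4p6 (R : realType) (m : nat) (hm : (1 <= m)%N) :
  exists eps : nat -> R,
    eps n @[n --> \oo] --> (0 : R) /\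
    forall n : nat, exists (Sigma : 'I_n -> int) (M : int),
      [/\ evaluation_distinct m Sigma,
          bounded_seq M Sigma &
          (M%:~R : R) <= 2 `^ (n%:R * (1 + eps n))].
Proof.
pose t n := up_log 2 'C(n, m).+1.
exists (fun n => (t n)%:R / n%:R); split; first exact: up_log_bin_div_cvg0.
move=> n; exists (@shifted_power (t n) n), (2 ^+ (t n + n)); split.
- by apply: shifted_power_distinct => //; exact: up_logP.
- move=> i; rewrite /shifted_power addr_ge0 ?exprn_ge0 //=.
  apply: (@le_trans _ _ (2 ^+ (t n + i).+1)); last first.
    by rewrite ler_weXn2l // -addnS leq_add2l.
  by rewrite exprS mulr_natl mulr2n lerD2r exprn_ege1.
- have -> : n%:R * (1 + (t n)%:R / n%:R) = (t n + n)%:R :> R.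
    (* For [n = 0] the division is by zero, but ['C(0, m) = 0] gives [t 0 = 0], so both sides
       vanish. *)
    case: n => [|n]; first by rewrite mul0r /t bin0n gtn_eqF // up_log1.
    by rewrite natrD mulrDr mulr1 addrC [n.+1%:R * _]mulrC divfK // pnatr_eq0.
  by rewrite powR_mulrn // rmorphXn.
Qed.
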